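(* Let $\vec r(t)=(x(t),y(t))$, $t_0<t<t_1$, be a simple curve of class $C^2$ in $\mathbb{R}^2$ that does not pass through the origin $O=(0,0)$. Let $P=P(t)=(x(t),y(t))$ be the moving point on this curve with parameter $t$. Then for every $t\in(t_0,t_1)$: (i) For $\mathcal{D}=|\overrightarrow{OP}|$, we have $$\frac{d\mathcal{D}}{dt}=\frac{x(t)x'(t)+y(t)y'(t)}{\sqrt{x^2(t)+y^2(t)}}.$$ (ii) The rotational speed of $\overrightarrow{OP}$ with respect to $t$ is $$\frac{|x(t)y'(t)-x'(t)y(t)|}{x^2(t)+y^2(t)}.$$
   Context: For a nowhere-zero differentiable vector function $\vec w(t)$, write $\vec e_{\vec w}=\vec w/|\vec w|$. The rotational speed of $\vec w$ with respect to $t$ is $\left|\frac{d\vec e_{\vec w}}{dt}\right|$. *)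

(* Defs.v *)
From Stdlib Require Import Reals.
From Coquelicot Require Import Coquelicot.
Open Scope R_scope.

(* Coquelicot's [norm] on R * R is the Euclidean norm
   sqrt (norm (fst v) ^ 2 + norm (snd v) ^ 2). *)
Definition vec (A B : R * R) : R * R := minus B A.

Definition unit_vector (v : R * R) : R * R := scal (/ norm v) v.

(* Relational, so that it includes the existence of the derivative of the
   unit vector; Coquelicot has a total derivative only for R -> R. *)
Definition is_rotational_speed (w : R -> R * R) (t v : R) : Prop :=
  exists l : R * R,
    is_derive (fun s => unit_vector (w s)) t l /\ v = norm l.

(* The endpoints may be infinite. *)
Definition in_interval (t0 t1 : Rbar) (t : R) : Prop :=
  Rbar_lt t0 t /\ Rbar_lt t t1.

(* [Derive] is total, so differentiability of every order up to [n] has to be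
   required separately. *)
Definition class_C (n : nat) (t0 t1 : Rbar) (f : R -> R) : Prop :=
  forall t, in_interval t0 t1 t ->
    (forall k, (k <= n)%nat -> ex_derive_n f k t) /\
    continuous (Derive_n f n) t.

Definition simple_curve (t0 t1 : Rbar) (r : R -> R * R) : Prop :=
  forall s t, in_interval t0 t1 s -> in_interval t0 t1 t -> r s = r t -> s = t.

(* Main.v *)
(* In the moving frame the derivative of the unit vector e = (x, y) / D is
   ((x y' - x' y) / D^2) (- y, x) / D: the radial part of the velocity drops
   out, and the vector (- y, x) / D has norm 1. *)
Require Import Defs.
From Stdlib Require Import Reals Lra.
From Coquelicot Require Import Coquelicot.
Open Scope R_scope.

(** Pairing, seen as a map on [U * V], is the identity and hence its own differential; the chain
    rule for maps of two arguments then applies. *)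
Lemma is_derive_pair (U V : NormedModule R_AbsRing) (f : R -> U) (g : R -> V)
    (t : R) (lf : U) (lg : V) :
  is_derive f t lf -> is_derive g t lg ->
  is_derive (fun s => (f s, g s)) t ((lf, lg) : U * V).
Proof.
intros Hf Hg.
apply (filterdiff_comp'_2 f g (fun u v => (u, v)) t
  (fun s => scal s lf) (fun s => scal s lg) (fun u v => (u, v)) Hf Hg).
apply filterdiff_ext_lin with (fun p : U * V => p).
- apply filterdiff_ext with (fun p : U * V => p); [now intros [u v]|].
  apply filterdiff_id.
- now intros [u v].
Qed.

Lemma norm_R2 (a b : R) : norm ((a, b) : R * R) = sqrt (a ^ 2 + b ^ 2).
Proof.
change (norm ((a, b) : R * R)) with (sqrt (Rabs a ^ 2 + Rabs b ^ 2)).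
now rewrite !pow2_abs.
Qed.

Lemma vec_origin (p : R * R) : vec (0, 0) p = p.
Proof.
destruct p as [a b]; unfold vec, minus, plus, opp; simpl.
unfold prod_plus, prod_opp, plus, opp; simpl.
now rewrite Ropp_0, !Rplus_0_r.
Qed.

Lemma norm2_pos (a b : R) : (a, b) <> (0, 0) -> 0 < a ^ 2 + b ^ 2.
Proof.
intros H.
destruct (Req_dec a 0) as [Ha|Ha].
- assert (Hb : b <> 0) by (intros Hb; apply H; congruence).
  generalize (pow2_gt_0 b Hb) (pow2_ge_0 a); lra.
- generalize (pow2_gt_0 a Ha) (pow2_ge_0 b); lra.
Qed.

Lemma is_derive_sqrt_norm2 (x y : R -> R) (t : R) :
  ex_derive x t -> ex_derive y t -> 0 < x t ^ 2 + y t ^ 2 ->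
  is_derive (fun s => sqrt (x s ^ 2 + y s ^ 2)) t
    ((x t * Derive x t + y t * Derive y t) / sqrt (x t ^ 2 + y t ^ 2)).
Proof.
intros Hx Hy Hpos.
assert (HN := sqrt_lt_R0 _ Hpos).
auto_derive.
- repeat split; trivial; simpl in *; lra.
- change (x t * (x t * 1) + y t * (y t * 1)) with (x t ^ 2 + y t ^ 2).
  change (Derive (fun s => x s)) with (Derive x).
  change (Derive (fun s => y s)) with (Derive y).
  field; lra.
Qed.

(** Product rule for [/ D] and [x]. Exchanging [x] and [y] changes the sign of the cross product, so
    the same formula also serves the second coordinate. *)
Lemma is_derive_unit_coord (x y : R -> R) (t : R) :
  ex_derive x t -> ex_derive y t -> 0 < x t ^ 2 + y t ^ 2 ->
  is_derive (fun s => / sqrt (x s ^ 2 + y s ^ 2) * x s) t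
    ((x t * Derive y t - Derive x t * y t) / (x t ^ 2 + y t ^ 2)
      * (- y t / sqrt (x t ^ 2 + y t ^ 2))).
Proof.
intros Hx Hy Hpos.
assert (HN := sqrt_lt_R0 _ Hpos).
assert (HNN := sqrt_sqrt _ (Rlt_le _ _ Hpos)).
evar_last.
- apply (is_derive_mult (fun s => / sqrt (x s ^ 2 + y s ^ 2)) x).
  + apply is_derive_inv; [apply is_derive_sqrt_norm2; trivial|lra].
  + now apply Derive_correct.
  + exact Rmult_comm.
- cbn -[pow sqrt].
  (* This also rewrites under the roots, leaving [sqrt (N * N)], which is collapsed below since [N]
     is positive. *)
  rewrite <- HNN.
  set (N := sqrt (x t ^ 2 + y t ^ 2)) in *.
  rewrite (sqrt_square N) by lra.
  (* Clearing denominators leaves x' (x^2 + y^2) - x (x x' + y y') = - y (x y' - x' y). *)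
  apply Rmult_eq_reg_r with (N ^ 3); [|apply pow_nonzero; lra].
  field_simplify; [|lra|lra].
  replace (N ^ 2) with (x t ^ 2 + y t ^ 2) by lra.
  ring.
Qed.

Theorem proposition2p1 (t0 t1 : Rbar) (x y : R -> R) :
  let O : R * R := (0, 0) in
  let P : R -> R * R := fun t => (x t, y t) in
  class_C 2 t0 t1 x ->
  class_C 2 t0 t1 y ->
  simple_curve t0 t1 P ->
  (forall t, in_interval t0 t1 t -> P t <> O) ->
  forall t, in_interval t0 t1 t ->
    is_derive (fun s => norm (vec O (P s))) t
      ((x t * Derive x t + y t * Derive y t) / sqrt (x t ^ 2 + y t ^ 2))
    /\
    is_rotational_speed (fun s => vec O (P s)) t
      (Rabs (x t * Derive y t - Derive x t * y t) / (x t ^ 2 + y t ^ 2)).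
Proof.
intros O P Cx Cy _ PO t Ht.
assert (Hx : ex_derive x t) by (apply (proj1 (Cx t Ht) 1%nat); auto).
assert (Hy : ex_derive y t) by (apply (proj1 (Cy t Ht) 1%nat); auto).
assert (Hpos := norm2_pos _ _ (PO t Ht)).
assert (HN := sqrt_lt_R0 _ Hpos).
assert (HNN := sqrt_sqrt _ (Rlt_le _ _ Hpos)).
split.
- apply is_derive_ext with (fun s => sqrt (x s ^ 2 + y s ^ 2)).
  + intros s; unfold O, P; now rewrite vec_origin, norm_R2.
  + now apply is_derive_sqrt_norm2.
(* [k] is the signed angular velocity; its absolute value is the claimed speed. *)
- set (k := (x t * Derive y t - Derive x t * y t) / (x t ^ 2 + y t ^ 2)).
  set (N := sqrt (x t ^ 2 + y t ^ 2)) in *.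
  exists (k * (- y t / N), k * (x t / N)); split.
  + apply is_derive_ext with (fun s =>
      (/ sqrt (x s ^ 2 + y s ^ 2) * x s, / sqrt (x s ^ 2 + y s ^ 2) * y s)).
    { intros s; unfold O, P, unit_vector; now rewrite vec_origin, norm_R2. }
    apply (is_derive_pair R_NormedModule R_NormedModule).
    * now apply is_derive_unit_coord.
    (* The sum is reordered to match the coordinate lemma with [x] and [y] exchanged; the two sign
       changes cancel. *)
    * apply is_derive_ext with (fun s => / sqrt (y s ^ 2 + x s ^ 2) * y s).
      { intros s; now rewrite Rplus_comm. }
      evar_last; [apply is_derive_unit_coord; trivial; lra|].
      unfold k, N; rewrite (Rplus_comm (y t ^ 2)); field.
      fold N; split; lra.
  + rewrite norm_R2.
    (* The squares add up to [k] squared because x^2 + y^2 = N^2, and the root of that is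
       [Rabs k]. *)
    replace ((k * (- y t / N)) ^ 2 + (k * (x t / N)) ^ 2) with (Rsqr k).
    * rewrite sqrt_Rsqr_abs; unfold k; rewrite Rabs_div by lra.
      now rewrite (Rabs_pos_eq (x t ^ 2 + y t ^ 2)) by lra.
    * replace ((k * (- y t / N)) ^ 2 + (k * (x t / N)) ^ 2)
        with (Rsqr k * ((x t ^ 2 + y t ^ 2) / (N * N)))
        by (unfold Rsqr; field; lra).
      rewrite HNN; field; lra.
Qed.
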